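(* Let $Y$ be a real vector space, $F\subseteq Y$, and suppose that $D\subset Y$ is a non-trivial algebraically closed convex cone with $\operatorname{core}D\ne\emptyset$. If $F\subseteq a-\operatorname{core}D$ or $F\subseteq a+\operatorname{core}D$ for some $a\in Y$, then $$\operatorname{WEff}(F,D)=\{y^0\in F\mid\exists k\in\operatorname{core}D:\ \varphi_{a-D,k}(y^0)=\min_{y\in F}\varphi_{a-D,k}(y)\}$$ and $$\operatorname{Eff}(F,D)=\{y^0\in F\mid\exists k\in\operatorname{core}D\ \forall y\in F\setminus\{y^0\}:\ \varphi_{a-D,k}(y^0)<\varphi_{a-D,k}(y)\}.$$ For $y^0\in\operatorname{WEff}(F,D)$, in the case $F\subseteq a-\operatorname{core}D$ one can choose $k=a-y^0$, which results in $\varphi_{a-D,k}(y^0)=-1$, whereas in the case $F\subseteq a+\operatorname{core}D$ one can choose $k=y^0-a$, which results in $\varphi_{a-D,k}(y^0)=1$.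
   Context: For $F,D\subseteq Y$, $\operatorname{Eff}(F,D):=\{y^0\in F\mid F\cap(y^0-D)\subseteq\{y^0\}\}$ and $\operatorname{WEff}(F,D):=\operatorname{Eff}(F,\operatorname{core}D)$. $\operatorname{core}D$ is the algebraic interior: $d\in\operatorname{core}D$ iff $d\in D$ and for each $v\in Y$ there is $\varepsilon>0$ with $d+sv\in D$ for all $s\in[0,\varepsilon]$. For nonempty $A\subseteq Y$ and $k\in Y\setminus\{0\}$, $\varphi_{A,k}(y):=\inf\{t\in\mathbb{R}\mid y\in A+tk\}$, where $\inf\emptyset:=\nu$ with $\nu$ a symbol not in $\mathbb{R}\cup\{-\infty,+\infty\}$, and the infimum is $-\infty$ if the set is unbounded below. A set $C\subseteq Y$ is a cone iff $\lambda c\in C$ for all $\lambda\in[0,\infty)$, $c\in C$; it is non-trivial iff $C\ne\emptyset$, $C\ne\{0\}$, $C\ne Y$. A set $C\subseteq Y$ is algebraically closed iff for all $c\in C$, $y\in Y$: if $c+\lambda(y-c)\in C$ for all $\lambda\in(0,1)$, then $y\in C$. *)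

(* Defs.v *)
From HB Require Import structures.
From mathcomp Require Import all_boot all_order all_algebra.
From mathcomp Require Import all_classical all_reals all_analysis.

Set Implicit Arguments.
Unset Strict Implicit.
Unset Printing Implicit Defensive.
Import Order.TTheory GRing.Theory Num.Theory.
Local Open Scope classical_set_scope.
Local Open Scope ring_scope.

Definition alg_core (R : realType) (Y : lmodType R) (D : set Y) : set Y :=
  [set d | D d /\
    forall v : Y, exists2 e : R, 0 < e &
      forall s : R, 0 <= s -> s <= e -> D (d + s *: v)].

Definition is_cone (R : realType) (Y : lmodType R) (C : set Y) : Prop :=
  forall (l : R) (c : Y), 0 <= l -> C c -> C (l *: c).

Definition nontrivial_cone (R : realType) (Y : lmodType R) (C : set Y) : Prop :=
  [/\ is_cone C, C <> set0, C <> [set 0] & C <> setT].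

Definition alg_closed (R : realType) (Y : lmodType R) (C : set Y) : Prop :=
  forall c y : Y, C c ->
    (forall l : R, 0 < l -> l < 1 -> C (c + l *: (y - c))) -> C y.

Definition Eff (R : realType) (Y : lmodType R) (F D : set Y) : set Y :=
  [set y0 | F y0 /\ F `&` [set y0 - d | d in D] `<=` [set y0]].

Definition WEff (R : realType) (Y : lmodType R) (F D : set Y) : set Y :=
  Eff F (alg_core D).

(* Extended reals together with the extra symbol [nu], encoded as [None].
   [nu] is comparable with nothing, not even with itself. *)
Definition ext_nu (R : realType) : Type := option (\bar R).

Definition nu_le (R : realType) (u v : ext_nu R) : Prop :=
  match u, v with Some x, Some y => (x <= y)%E | _, _ => False end.

Definition nu_lt (R : realType) (u v : ext_nu R) : Prop :=
  match u, v with Some x, Some y => (x < y)%E | _, _ => False end.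

Definition is_min (R : realType) (S : set (ext_nu R)) (m : ext_nu R) : Prop :=
  S m /\ forall u, S u -> nu_le m u.

(* The case split is needed because [ereal_inf set0] is [+oo], not [nu]. *)
Definition phi (R : realType) (Y : lmodType R) (A : set Y) (k y : Y) :
    ext_nu R :=
  let T := [set t : R | [set z + t *: k | z in A] y] in
  if T == set0 then None else Some (ereal_inf [set t%:E | t in T]).

(* Main.v *)
Require Import Defs.
From mathcomp Require Import all_boot all_order all_algebra.
From mathcomp Require Import all_classical all_reals all_analysis.
From mathcomp Require Import lra.
Import Order.TTheory GRing.Theory Num.Theory.
Local Open Scope classical_set_scope.
Local Open Scope ring_scope.

(** In the direction [k], the set [a - D + t k] contains [y] exactly when
    [a - y + t k] lies in [D].  For [k] in the core of [D], these [t] form a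
    closed half-line [m <= t]: it goes up since [D] is stable by addition, it
    is nonempty since [k] is a core point, bounded below since otherwise
    algebraic closedness would put [- k] in [D], which forces [D] to be the
    whole space, and it contains its infimum by algebraic closedness again.
    Moreover [a - y + t k] is a core point exactly when [m < t].  So
    [phi (a - D) k y = m] is always a real number, and the comparisons [m <= t]
    and [m < t] read as membership in [D] and in its core ([phi_halfline]).

    A scalarized minimum [y0] is therefore efficient: if [y0 - y] is in [D]
    (resp. in the core), then adding it to the boundary point
    [a - y0 + phi(y0) k] gives [phi(y) <= phi(y0)] (resp. [<]).

    Conversely the direction is chosen so that [y0 = a + s k] for some real
    [s].  Then [phi(y0) = s], while [a - y + s k = y0 - y], so that
    [phi(y) <= s] (resp. [phi(y) < s]) means that [y0 - y] is in [D] (resp. in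
    its core): weak efficiency of [y0] says that [phi] is minimal at [y0], and
    efficiency that it is strictly minimal.  The two hypotheses on [F] are the
    cases [s = -1] and [s = 1]. *)

(** * Convex cones and their algebraic interior *)

Section ConvexCone.
Context {R : realType} {Y : lmodType R} {D : set Y}.
Hypotheses (Dcone : is_cone D) (Dconv : convex_set D).

Lemma convex_cone_add x y : D x -> D y -> D (x + y).
Proof.
move=> Dx Dy.
have h0 : (0 : R) <= 2^-1 by lra.
have h1 : (2^-1 : R) <= 1 by lra.
have := Dconv x y (Itv01 h0 h1); rewrite !inE => /(_ Dx Dy) Dxy.
have -> : x + y = 2 *: (2^-1 *: x + (1 - 2^-1) *: y).
  rewrite scalerDr !scalerA.
  have -> : (2 * 2^-1 : R) = 1 by lra.
  have -> : (2 * (1 - 2^-1) : R) = 1 by lra.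
  by rewrite !scale1r.
exact: Dcone.
Qed.

Lemma alg_core_sub : alg_core D `<=` D.
Proof. by move=> x []. Qed.

Lemma alg_core_addr x y : alg_core D x -> D y -> alg_core D (x + y).
Proof.
move=> [Dx xcore] Dy; split; first exact: convex_cone_add.
move=> v; have [e e0 He] := xcore v; exists e => // s s0 se.
by rewrite addrAC; apply: convex_cone_add => //; exact: He.
Qed.

Lemma alg_core_scale l x : 0 < l -> alg_core D x -> alg_core D (l *: x).
Proof.
move=> l0 [Dx xcore]; split; first by apply: Dcone => //; exact: ltW.
move=> v; have [e e0 He] := xcore (l^-1 *: v); exists e => // s s0 se.
have -> : l *: x + s *: v = l *: (x + s *: (l^-1 *: v)).
  by rewrite scalerDr !scalerA mulrAC mulfV ?mul1r // gt_eqF.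
by apply: Dcone; [exact: ltW | exact: He].
Qed.

(** A core point at the apex gives a small multiple of every vector, and a cone
    does not distinguish a vector from its small multiples. *)
Lemma alg_core0_setT : alg_core D 0 -> D = setT.
Proof.
move=> [_ core0]; rewrite -subTset => v _.
have [e e0 He] := core0 v.
have -> : v = e^-1 *: (e *: v) by rewrite scalerA mulVf ?scale1r // gt_eqF.
apply: Dcone; first by rewrite invr_ge0 ltW.
by rewrite -[e *: v]add0r; exact: He (ltW e0) _.
Qed.

Hypothesis DnT : D <> setT.

Lemma alg_core_opp k : alg_core D k -> ~ D (- k).
Proof.
move=> kcore Dk; apply: DnT; apply: alg_core0_setT.
by rewrite -(subrr k); exact: alg_core_addr.
Qed.

Lemma alg_core_neq0 : ~ alg_core D 0.
Proof. by move=> /alg_core0_setT. Qed.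

(** * Lines in the direction of a core point *)

Section Line.
Variables (b k : Y).
Hypothesis kcore : alg_core D k.

Let kline t s : b + t *: k = b + s *: k + (t - s) *: k.
Proof. by rewrite -addrA -scalerDl subrKC. Qed.

Lemma line_upward t s : D (b + s *: k) -> s <= t -> D (b + t *: k).
Proof.
move=> Ds st; rewrite (kline t s); apply: convex_cone_add => //.
by apply: Dcone; [rewrite subr_ge0 | exact: alg_core_sub].
Qed.

Lemma line_nonempty : [set t | D (b + t *: k)] !=set0.
Proof.
have [_ /(_ b)[e e0 He]] := kcore; exists e^-1 => /=.
have -> : b + e^-1 *: k = e^-1 *: (k + e *: b).
  by rewrite scalerDr scalerA mulVf ?scale1r 1?addrC // gt_eqF.
by apply: Dcone; [rewrite invr_ge0 ltW | exact: He (ltW e0) _].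
Qed.

Hypothesis Dclosed : alg_closed D.

(** If the whole line [b + t k] were in [D], so would, up to a scaling by
    [1 - l], be the open segment from [b] to [- k], hence [- k] itself. *)
Lemma line_has_lbound : has_lbound [set t | D (b + t *: k)].
Proof.
apply: contrapT => nlb; apply: (alg_core_opp k kcore).
have Dline t : D (b + t *: k).
  apply: contrapT => nDt; apply: nlb; exists t => s /= Ds.
  by rewrite leNgt; apply/negP => /ltW /(line_upward t s Ds).
apply: (Dclosed b); first by have := Dline 0; rewrite scale0r addr0.
move=> l l0 l1; have l1' : 1 - l != 0 by rewrite subr_eq0 gt_eqF.
have -> : b + l *: (- k - b) = (1 - l) *: (b + (- l / (1 - l)) *: k).
  rewrite [RHS]scalerDr scalerA mulrCA divff // mulr1 scalerBl scale1r.
  by rewrite scalerBr scalerN scaleNr addrA addrAC.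
by apply: Dcone; rewrite // subr_ge0 ltW.
Qed.

(** Algebraic closedness is applied to the segment that descends from the
    parameter [m + 1] to the infimum [m]. *)
Lemma line_inf_mem : D (b + inf [set t | D (b + t *: k)] *: k).
Proof.
set m := inf _.
have Dabove t : m < t -> D (b + t *: k).
  by move=> /(inf_lt line_nonempty)[s Ds /ltW st]; exact: line_upward Ds st.
apply: (Dclosed (b + (m + 1) *: k)); first by apply: Dabove; lra.
move=> l l0 l1; rewrite opprD addrACA subrr add0r -scalerBl scalerA -addrA.
by rewrite -scalerDl; apply: Dabove; lra.
Qed.

Lemma line_inf_le t :
  D (b + t *: k) <-> inf [set t | D (b + t *: k)] <= t.
Proof.
split; last exact: line_upward line_inf_mem.
exact: ge_inf line_has_lbound t.
Qed.

(** Above the infimum a positive multiple of [k] is added to a point of [D];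
    conversely, at a core point one can still move a little along [- k]. *)
Lemma line_inf_lt t :
  alg_core D (b + t *: k) <-> inf [set t | D (b + t *: k)] < t.
Proof.
split=> [[_ /(_ (- k))[e e0 He]]|mt].
- have : D (b + (t - e) *: k).
    by rewrite scalerBl addrA -scalerN; exact: He (ltW e0) _.
  by move=> /line_inf_le; lra.
- rewrite (kline t (inf [set t | D (b + t *: k)])) addrC.
  apply: alg_core_addr line_inf_mem.
  by apply: alg_core_scale; rewrite // subr_gt0.
Qed.

End Line.

(** * The scalarizing functional *)

Hypothesis Dclosed : alg_closed D.
Variable a : Y.
Let aD : set Y := [set a - d | d in D].

Lemma translate_subE k y t :
  [set z + t *: k | z in aD] y <-> D (a - y + t *: k).
Proof.
split=> [[_ [d Dd <-] <-]|Dy].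
- by rewrite opprD addrA subrK subKr.
- exists (y - t *: k); last by rewrite subrK.
  exists (a - y + t *: k) => //.
  by rewrite opprD opprB addrA subrKC.
Qed.

(** The only information on [phi] that the scalarization uses: its value is a
    real number, which cuts the line [a - y + t k] into the part outside [D],
    one boundary point, and core points. *)
Lemma phi_halfline k y : alg_core D k ->
  exists m : R, [/\ phi aD k y = Some m%:E,
    forall t, D (a - y + t *: k) <-> m <= t &
    forall t, alg_core D (a - y + t *: k) <-> m < t].
Proof.
move=> kcore; exists (inf [set t | D (a - y + t *: k)]).
split=> [|t|t]; [|exact: line_inf_le|exact: line_inf_lt].
rewrite /phi.
have -> : [set t | [set z + t *: k | z in aD] y] = [set t | D (a - y + t *: k)].
  by apply/seteqP; split=> t /= /translate_subE.
have /set0P/negbTE -> := line_nonempty (a - y) k kcore.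
by rewrite ereal_inf_EFin //; [exact: line_has_lbound | exact: line_nonempty].
Qed.

(** * Scalarized minima and efficient points *)

Section Scalarization.
Variables (F : set Y) (k y0 : Y).
Hypotheses (kcore : alg_core D k) (Fy0 : F y0).

Let sub_shift y t : a - y + t *: k = a - y0 + t *: k + (y0 - y).
Proof. by rewrite [RHS]addrAC (addrA (a - y0)) subrK. Qed.

(** A core vector added to the boundary point [a - y0 + phi(y0) k] gives a core
    point, so that a point [y] below [y0] in the order of the core has a
    strictly smaller value. *)
Lemma WEff_of_is_min :
  is_min [set phi aD k y | y in F] (phi aD k y0) -> WEff F D y0.
Proof.
move=> [_ ymin]; split=> // y [Fy [d dcore dE]]; exfalso.
have yE : y0 - y = d by rewrite -dE opprB subrKC.
have [m0 [phi0 m0le _]] := phi_halfline k y0 kcore.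
have [m [phiy _ mlt]] := phi_halfline k y kcore.
have : nu_le (phi aD k y0) (phi aD k y) by apply: ymin; exists y.
rewrite phi0 phiy /= lee_fin leNgt => /negP; apply.
apply/mlt; rewrite sub_shift yE addrC; apply: alg_core_addr => //.
exact/m0le.
Qed.

Lemma Eff_of_strict_min :
  (forall y, (F `\ y0) y -> nu_lt (phi aD k y0) (phi aD k y)) -> Eff F D y0.
Proof.
move=> ymin; split=> // y [Fy [d Dd dE]] /=; apply: contrapT => yy0.
have yE : y0 - y = d by rewrite -dE opprB subrKC.
have [m0 [phi0 m0le _]] := phi_halfline k y0 kcore.
have [m [phiy mle _]] := phi_halfline k y kcore.
have : nu_lt (phi aD k y0) (phi aD k y) by apply: ymin; split.
rewrite phi0 phiy /= lte_fin ltNge => /negP; apply.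
apply/mle; rewrite sub_shift yE; apply: convex_cone_add => //.
exact/m0le.
Qed.

(** From here on the line through [a] in the direction [k] passes through
    [y0], so that at the parameter [s] the line of any [y] passes through
    [y0 - y]. *)
Variable s : R.
Hypothesis y0E : y0 = a + s *: k.

Let subE y : a - y + s *: k = y0 - y.
Proof. by rewrite y0E addrAC. Qed.

(** At the parameter [s], the line of [y0] passes through [0], which belongs to
    [D] but not to its core. *)
Lemma phi_on_line : phi aD k y0 = Some s%:E.
Proof.
have [m [-> mle mlt]] := phi_halfline k y0 kcore.
have ms : m <= s.
  apply/mle; rewrite subE subrr -(scale0r k).
  by apply: Dcone => //; exact: alg_core_sub.
have /negP : ~ m < s by move/mlt; rewrite subE subrr; exact: alg_core_neq0.
by rewrite -leNgt => sm; congr (Some _%:E); apply/le_anti/andP.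
Qed.

Lemma is_min_of_WEff :
  WEff F D y0 -> is_min [set phi aD k y | y in F] (phi aD k y0).
Proof.
move=> [_ eff0]; split; first by exists y0.
move=> _ [y Fy <-]; rewrite phi_on_line.
have [m [-> _ mlt]] := phi_halfline k y kcore.
rewrite /= lee_fin leNgt; apply/negP => /mlt; rewrite subE => ycore.
have yy0 : y = y0.
  by apply: eff0; split=> //; exists (y0 - y); rewrite // opprB subrKC.
by apply: alg_core_neq0; rewrite -(subrr y0) -{2}yy0.
Qed.

Lemma strict_min_of_Eff : Eff F D y0 ->
  forall y, (F `\ y0) y -> nu_lt (phi aD k y0) (phi aD k y).
Proof.
move=> [_ eff0] y [Fy yy0]; rewrite phi_on_line.
have [m [-> mle _]] := phi_halfline k y kcore.
rewrite /= lte_fin ltNge; apply/negP => /mle; rewrite subE => Dy.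
apply: yy0; apply: eff0; split=> //.
by exists (y0 - y); rewrite // opprB subrKC.
Qed.

End Scalarization.

End ConvexCone.

Theorem theorem9 (R : realType) (Y : lmodType R) (F D : set Y) (a : Y)
    (hD : nontrivial_cone D) (hDclosed : alg_closed D) (hDconvex : convex_set D)
    (hDcore : alg_core D !=set0)
    (hF : F `<=` [set a - d | d in alg_core D] \/
          F `<=` [set a + d | d in alg_core D]) :
  let aD := [set a - d | d in D] in
  [/\ WEff F D =
        [set y0 | F y0 /\ exists2 k : Y, alg_core D k &
           is_min [set phi aD k y | y in F] (phi aD k y0)],
      Eff F D =
        [set y0 | F y0 /\ exists2 k : Y, alg_core D k &
           forall y : Y, (F `\ y0) y -> nu_lt (phi aD k y0) (phi aD k y)],
      F `<=` [set a - d | d in alg_core D] ->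
        forall y0 : Y, WEff F D y0 ->
          let k := a - y0 in
          [/\ alg_core D k,
              is_min [set phi aD k y | y in F] (phi aD k y0),
              Eff F D y0 ->
                forall y : Y, (F `\ y0) y -> nu_lt (phi aD k y0) (phi aD k y) &
              phi aD k y0 = Some ((-1)%:E)] &
      F `<=` [set a + d | d in alg_core D] ->
        forall y0 : Y, WEff F D y0 ->
          let k := y0 - a in
          [/\ alg_core D k,
              is_min [set phi aD k y | y in F] (phi aD k y0),
              Eff F D y0 ->
                forall y : Y, (F `\ y0) y -> nu_lt (phi aD k y0) (phi aD k y) &
              phi aD k y0 = Some (1%:E)]].
Proof.
move=> aD; have [Dcone _ _ DnT] := hD.
have below y0 : F `<=` [set a - d | d in alg_core D] -> F y0 ->
    alg_core D (a - y0) /\ y0 = a + (-1) *: (a - y0).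
  move=> FaD /FaD [d dcore dE].
  by rewrite scaleN1r opprB subrKC -{1}dE opprB subrKC.
have above y0 : F `<=` [set a + d | d in alg_core D] -> F y0 ->
    alg_core D (y0 - a) /\ y0 = a + 1 *: (y0 - a).
  move=> FaD /FaD [d dcore dE].
  by rewrite scale1r subrKC -{1}dE addrAC subrr add0r.
have direction y0 : F y0 ->
    exists k s, alg_core D k /\ y0 = a + s *: k.
  move=> Fy0; case: hF => FaD.
  - by exists (a - y0), (-1); exact: below.
  - by exists (y0 - a), 1; exact: above.
split.
- apply/seteqP; split=> y0 /=.
  + move=> weff; have Fy0 := proj1 weff; split=> //.
    have [k [s [kcore y0E]]] := direction y0 Fy0; exists k => //.
    exact: is_min_of_WEff y0E weff.
  + by move=> [Fy0 [k kcore ymin]]; exact: WEff_of_is_min ymin.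
- apply/seteqP; split=> y0 /=.
  + move=> eff; have Fy0 := proj1 eff; split=> //.
    have [k [s [kcore y0E]]] := direction y0 Fy0; exists k => //.
    exact: strict_min_of_Eff y0E eff.
  + by move=> [Fy0 [k kcore ymin]]; exact: Eff_of_strict_min ymin.
- move=> FaD y0 weff k; have Fy0 := proj1 weff.
  have [kcore y0E] := below y0 FaD Fy0; split=> //.
  + exact: is_min_of_WEff y0E weff.
  + exact: strict_min_of_Eff y0E.
  + exact: phi_on_line y0E.
- move=> FaD y0 weff k; have Fy0 := proj1 weff.
  have [kcore y0E] := above y0 FaD Fy0; split=> //.
  + exact: is_min_of_WEff y0E weff.
  + exact: strict_min_of_Eff y0E.
  + exact: phi_on_line y0E.
Qed.
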